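(* (Sufficiency.) Let $\kappa:[a,b]\to\mathbb{R}$ be an everywhere positive function of class $C^1$ and let $\tau:[a,b]\to\mathbb{R}$ be a function of class $C^0$. If $\xi=\xi(s)$ is a solution of $$\frac{d}{ds}\left\{\frac{1}{\kappa}\frac{dw}{ds}\right\}=-\kappa w+\tau\sqrt{1-w^2-\left(\frac{1}{\kappa}\frac{dw}{ds}\right)^2},\qquad w(s_0)=w_0,\quad w'(s_0)=v_0,$$ where $s_0\in(a+\epsilon,b-\epsilon)$, $(w_0,v_0)\in\{(w,v)\in\mathbb{R}^2\mid w^2+\frac{v^2}{\kappa_0^2}<1\}$ and $\kappa_0=\min\{\kappa(s)\mid s\in[a+\epsilon,b-\epsilon]\}$, for some $\epsilon>0$, then $\alpha(s)=(x(s),y(s),z(s))$, where $$x(s)=\int\sqrt{1-\xi^2}\,\cos\left(\int\frac{\sqrt{(1-\xi^2)\kappa^2-(\xi')^2}}{1-\xi^2}\,ds\right)ds,$$ $$y(s)=\int\sqrt{1-\xi^2}\,\sin\left(\int\frac{\sqrt{(1-\xi^2)\kappa^2-(\xi')^2}}{1-\xi^2}\,ds\right)ds,$$ $$z(s)=\int\xi\,ds,$$ is a curve parametrized by arc length $s$, $\kappa=\kappa(s)$ is the curvature, and $\tau=\tau(s)$ is the torsion of $\alpha$. (Reciprocally.) Let $\alpha:I\to\mathbb{R}^3$ be a curve parametrized by arc length $s$, where $\kappa=\kappa(s)$ is its curvature and $\tau=\tau(s)$ is its torsion; let $\mathbf{t}_0,\mathbf{n}_0,\mathbf{b}_0$ be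 the Frenet trihedron of $\alpha$ at $s=s_0\in I$, and consider the canonical basis $\{\mathbf{e}_i\mid i=1,2,3\}$ of $\mathbb{R}^3$. Then there exists an orthogonal linear map $\sigma$ of $\mathbb{R}^3$ with positive determinant such that the components $w=\langle\mathbf{t}_\beta(s),\mathbf{e}_i\rangle$ of the tangent vector $\mathbf{t}_\beta$ of the curve $\beta=\sigma\circ\alpha$ satisfy the initial value problem $$\frac{d}{ds}\left\{\frac{1}{\kappa}\frac{dw}{ds}\right\}=-\kappa w+\tau\sqrt{1-w^2-\left(\frac{1}{\kappa}\frac{dw}{ds}\right)^2},\qquad w(s_0)=\langle\sigma(\mathbf{t}_0),\mathbf{e}_i\rangle,\quad w'(s_0)=\langle\kappa(s_0)\,\sigma(\mathbf{n}_0),\mathbf{e}_i\rangle,$$ in some neighborhoods $I_i$ of $s_0\in I$, for $i=1,2,3$, respectively.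
   Context: The indefinite integrals denote antiderivatives, the same inner antiderivative being used in $x$ and $y$. For a curve parametrized by arc length $s$, $\mathbf{t}=\alpha'$ is the tangent vector and the curvature is $\kappa=\|\alpha''\|$, taken to be positive; one sets $\mathbf{n}=\alpha''/\kappa$ and $\mathbf{b}=\mathbf{t}\wedge\mathbf{n}$. The triple $\mathbf{t},\mathbf{n},\mathbf{b}$ is the Frenet trihedron, and the torsion $\tau$ is given by the Frenet equations $\frac{d\mathbf{t}}{ds}=\kappa\mathbf{n}$, $\frac{d\mathbf{n}}{ds}=-\kappa\mathbf{t}+\tau\mathbf{b}$, $\frac{d\mathbf{b}}{ds}=-\tau\mathbf{n}$. $\langle\cdot,\cdot\rangle$ is the standard scalar product on $\mathbb{R}^3$, and $\mathbf{t}_\beta$ is the tangent vector of $\beta$.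
   Formalization: Sufficiency is stated on intervals around s_0 where 1-ξ²-(ξ'/κ)²>0 (proved to hold near s_0); otherwise it is false: with κ=τ=1 a solution can reach 1-ξ²-(ξ')²=0 and continue as a sine, making the curve planar although τ=1. *)

(* Defs.v *)
From HB Require Import structures.
From mathcomp Require Import all_boot all_order all_algebra.
From mathcomp Require Import all_classical all_reals all_analysis.
Set Implicit Arguments.
Unset Strict Implicit.
Unset Printing Implicit Defensive.
Import Order.TTheory GRing.Theory Num.Theory.
Import numFieldNormedType.Exports.
Local Open Scope classical_set_scope.
Local Open Scope ring_scope.

(* R^3 is 'rV[R]_3.  MathComp-Analysis gives 'rV[R]_3 the sup norm, which
   defines the right topology; lengths must use the Euclidean norm below. *)
Definition vec3 (R : realType) (x y z : R) : 'rV[R]_3 :=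
  \row_(i < 3) [:: x; y; z]`_i.

Definition dot (R : realType) (u v : 'rV[R]_3) : R :=
  \sum_(i < 3) u 0 i * v 0 i.

Definition enorm (R : realType) (u : 'rV[R]_3) : R := Num.sqrt (dot u u).

Definition cross (R : realType) (u v : 'rV[R]_3) : 'rV[R]_3 :=
  vec3 (u 0 1 * v 0 2 - u 0 2 * v 0 1)
       (u 0 2 * v 0 0 - u 0 0 * v 0 2)
       (u 0 0 * v 0 1 - u 0 1 * v 0 0).

(* Intervals of any shape (open, closed, half-open, unbounded), but neither
   empty nor reduced to a point. *)
Definition nondegenerate_interval (R : realType) (D : set R) : Prop :=
  is_interval D /\ exists x y, [/\ D x, D y & x < y].

(* The function df is the derivative of f on D, the difference quotient being
   taken inside D: it is one-sided at an end point of an interval D, and the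
   usual derivative in its interior.  Conversely, f is then an antiderivative
   of df on D. *)
Definition is_derive_on (R : realType) (V : normedModType R) (D : set R)
    (f df : R -> V) : Prop :=
  forall s, D s ->
    (fun u => (u - s)^-1 *: (f u - f s)) @ within D s^' --> df s.

Lemma is_derive_on_open (R : realType) (V : normedModType R) (D : set R)
    (f df : R -> V) : open D ->
  is_derive_on D f df <-> (forall s, D s -> is_derive s 1 f (df s)).
Proof.
move=> oD.
suff E s : D s -> (fun u => (u - s)^-1 *: (f u - f s)) @ within D s^' =
    (fun h => h^-1 *: ((f \o shift s) (h *: 1) - f s)) @ 0^'.
  split=> [H s Ds|H s Ds].
    have := H _ Ds; rewrite E// => c.
    by apply: DeriveDef; [apply/cvg_ex; exists (df s) | apply/cvg_lim: c].
  by rewrite E//; have [/[swap] <-] := H _ Ds.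
move=> Ds.
have Dn : \forall x \near s, D x by exact: open_nbhs_nbhs.
rewrite (near_shift 0 s) subr0 in Dn.
apply/predeqP => A.
rewrite -[X in X <-> _]/(\forall u \near s, u != s -> D u -> A ((u - s)^-1 *: (f u - f s))).
rewrite -[X in _ <-> X]/(\forall h \near 0, h != 0 -> A (h^-1 *: (f (h *: 1 + s) - f s))).
rewrite (near_shift 0 s) /= subr0; split=> H; near=> h => h0.
- have := near H h; rewrite /= -subr_eq0 addrK /GRing.scale /= mulr1; apply=> //.
  by near: h.
- move=> _; have := near H h; rewrite /= /GRing.scale /= mulr1 addrK; apply=> //.
  by move: h0; rewrite /= -subr_eq0 addrK.
Unshelve. all: by end_near.
Qed.

Definition C1_on (R : realType) (D : set R) (f : R -> R^o) : Prop :=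
  exists df : R -> R^o, is_derive_on D f df /\ {within D, continuous df}.

Definition is_min_on (R : realType) (D : set R) (f : R -> R) (m : R) : Prop :=
  (f @` D) m /\ lbound (f @` D) m.

(* t, n, b is the Frenet trihedron of the curve alpha parametrized by arc
   length on I, kappa its (positive) curvature and tau its torsion.  The first
   Frenet equation is the definition of n. *)
Definition frenet (R : realType) (I : set R) (alpha : R -> 'rV[R]_3)
    (kappa tau : R -> R) (t n b : R -> 'rV[R]_3) : Prop :=
  [/\ is_derive_on I alpha t /\ (forall s, I s -> enorm (t s) = 1),
      exists2 acc : R -> 'rV[R]_3, is_derive_on I t acc &
        forall s, I s -> [/\ kappa s = enorm (acc s), 0 < kappa s &
                             n s = (kappa s)^-1 *: acc s],
      forall s, I s -> b s = cross (t s) (n s),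
      is_derive_on I n (fun s => - kappa s *: t s + tau s *: b s) &
      is_derive_on I b (fun s => - tau s *: n s)].

Definition radicand (R : realType) (kappa w dw : R -> R) (s : R) : R :=
  1 - w s ^+ 2 - ((kappa s)^-1 * dw s) ^+ 2.

(* w, with derivative dw, solves on D the initial value problem
     ((1/kappa) w')' = - kappa w + tau sqrt (1 - w^2 - ((1/kappa) w')^2),
     w(s0) = w0,  w'(s0) = v0.
   Num.sqrt vanishes on negative numbers, so that the equation makes sense has
   to be required explicitly. *)
Definition ivp_solution (R : realType) (D : set R) (kappa tau : R -> R)
    (s0 w0 v0 : R) (w dw : R -> R^o) : Prop :=
  [/\ is_derive_on D w dw,
      forall s, D s -> 0 <= radicand kappa w dw s,
      is_derive_on D (fun s => (kappa s)^-1 * dw s : R^o)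
        (fun s => - kappa s * w s
                  + tau s * Num.sqrt (radicand kappa w dw s)),
      D s0 & w s0 = w0 /\ dw s0 = v0].

(* Main.v *)
Require Import Defs.
From mathcomp Require Import all_boot all_order all_algebra.
From mathcomp Require Import ring lra.
From mathcomp Require Import all_classical all_reals all_analysis.
Import Order.TTheory GRing.Theory Num.Theory.
Import numFieldNormedType.Exports.
Local Open Scope classical_set_scope.
Local Open Scope ring_scope.

(** The equation is one coordinate of the Frenet equations.  Fix a unit vector
    e and let w, q, P be the components of t, n, b along e.  Then w' = kappa q
    and q' = - kappa w + tau P; since t, n, b is an orthonormal basis,
    w^2 + q^2 + P^2 = 1, so that P is, up to sign, the square root of
    1 - w^2 - (w' / kappa)^2.  The equation says in addition that P >= 0.

    Sufficiency.  Put q = xi' / kappa, P = sqrt (1 - xi^2 - q^2) and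
    r = sqrt (1 - xi^2).  The tangent of the curve is the point of the unit
    sphere with height xi, distance r to the vertical axis and longitude theta.
    In the basis that turns with theta (radial, angular, vertical) the frame is
      t = (r, 0, xi), n = (- xi q / r, P / r, q), b = (- xi P / r, - q / r, P),
    and theta' = kappa P / r^2 is the speed for which t' = kappa n.  The
    equation for xi is the vertical coordinate of n' = - kappa t + tau b; its
    other two coordinates follow by computation, and the equation for b' follows
    from b = t x n.  This is frenet_cyl.

    Necessity.  Only the sign of P has to be arranged, for the three coordinate
    axes at once: a rotation takes b(s0) to the unit vector (1, 2, 2) / 3
    (exists_rotation_positive), and by continuity the three components of the
    rotated binormal remain positive near s0 (frenet_ivp).

    Derivatives are taken inside the domain of the curve, so the usual rules of
    calculus are first established for them. *)

Set Implicit Arguments.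
Unset Strict Implicit.
Unset Printing Implicit Defensive.

(** * Derivatives relative to a subset of the line *)

Lemma is_derive_on_eq (R : realType) (V : normedModType R) (D : set R)
    (f g df dg : R -> V) :
  is_derive_on D f df ->
  (forall s, D s -> f s = g s) -> (forall s, D s -> df s = dg s) ->
  is_derive_on D g dg.
Proof.
move=> fd fg dfg s Ds; rewrite -dfg //.
apply: cvg_trans (fd s Ds); apply: near_eq_cvg.
by rewrite near_withinE; apply: nearW => u Du /=; rewrite !fg.
Qed.

Lemma is_derive_on_subset (R : realType) (V : normedModType R) (D E : set R)
    (f df : R -> V) :
  E `<=` D -> is_derive_on D f df -> is_derive_on E f df.
Proof.
move=> ED fd s Es; apply: cvg_trans (fd s (ED s Es)).
apply: cvg_app; exact: within_subset.
Qed.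

Lemma is_derive_on_cvg (R : realType) (V : normedModType R) (D : set R)
    (f df : R -> V) (s : R) :
  is_derive_on D f df -> D s -> f u @[u --> within D s^'] --> f s.
Proof.
move=> fd Ds.
have us : (u - s) @[u --> within D s^'] --> (0 : R).
  rewrite -(subrr s); apply: cvgB; last exact: cvg_cst.
  apply: cvg_within_filter; exact: nbhs_dnbhs.
(* f u is recovered from its difference quotient. *)
have H : (u - s) *: ((u - s)^-1 *: (f u - f s)) + f s
    @[u --> within D s^'] --> 0 *: df s + f s.
  by apply: cvgD; [apply: cvgZ => //; exact: fd | exact: cvg_cst].
rewrite scale0r add0r in H; apply: cvg_trans H; apply: near_eq_cvg.
rewrite near_withinE; near=> u => _ /=.
have us0 : u - s != 0 by rewrite subr_eq0; near: u; exact: nbhs_dnbhs_neq.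
by rewrite scalerA divff // scale1r subrK.
Unshelve. all: by end_near. Qed.

Lemma is_derive_on_near_gt0 (R : realType) (D : set R) (f df : R -> R^o)
    (s : R) :
  is_derive_on D f df -> D s -> 0 < f s -> \forall u \near s, D u -> 0 < f u.
Proof.
move=> fd Ds fs0.
have H : \forall u \near within D s^', 0 < f u.
  exact: cvgr_gt (is_derive_on_cvg fd Ds) _ fs0.
rewrite near_withinE /dnbhs near_withinE in H.
near=> u => Du; have [->//|us] := eqVneq u s.
have := near H u; apply => //.
Unshelve. all: by end_near. Qed.

(** Every point of a nondegenerate interval is a limit of other points of it;
    derivatives are unique there for this reason. *)
Lemma nondegenerate_within_proper (R : realType) (D : set R) (s : R) :
  nondegenerate_interval D -> D s -> ProperFilter (within D s^').
Proof.
move=> [itvD [x [y [Dx Dy xy]]]] Ds.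
apply: Build_ProperFilter_ex => A.
rewrite /within /= /dnbhs => /nbhs_ballP[e /= e0 H].
have [ys|sy] := leP y s.
  have xs : x < s by lra.
  exists (Num.max x (s - e / 2)); apply: H => /=.
  - by rewrite /ball /= lter_distlC; case: (leP x (s - e / 2)) => ?; lra.
  - by rewrite lt_eqF// gt_max xs /=; lra.
  - by apply: (itvD x s) => //; rewrite le_max lexx /= ge_max; lra.
exists (Num.min y (s + e / 2)); apply: H => /=.
- by rewrite /ball /= lter_distlC; case: (leP y (s + e / 2)) => ?; lra.
- by rewrite gt_eqF// lt_min sy /=; lra.
- by apply: (itvD s y) => //; rewrite ge_min lexx /= le_min; lra.
Qed.

Lemma is_derive_on_unique (R : realType) (D : set R) (f df dg : R -> R^o)
    (s : R) :
  nondegenerate_interval D -> is_derive_on D f df -> is_derive_on D f dg ->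
  D s -> df s = dg s.
Proof.
move=> nD fd gd Ds; have ? := nondegenerate_within_proper nD Ds.
exact: (cvg_unique _ (fd s Ds) (gd s Ds)).
Qed.

Lemma is_derive_on_cst (R : realType) (V : normedModType R) (D : set R)
    (a : V) : is_derive_on D (fun=> a) (fun=> 0).
Proof.
move=> s _; under eq_fun do rewrite subrr scaler0; exact: cvg_cst.
Qed.

Lemma is_derive_onD (R : realType) (V : normedModType R) (D : set R)
    (f g df dg : R -> V) :
  is_derive_on D f df -> is_derive_on D g dg ->
  is_derive_on D (fun s => f s + g s) (fun s => df s + dg s).
Proof.
move=> fd gd s Ds.
under eq_fun do rewrite opprD addrACA scalerDr.
exact: cvgD (fd s Ds) (gd s Ds).
Qed.

Lemma is_derive_onM (R : realType) (D : set R) (f g df dg : R -> R^o) :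
  is_derive_on D f df -> is_derive_on D g dg ->
  is_derive_on D (fun s => f s * g s : R^o)
                 (fun s => df s * g s + f s * dg s).
Proof.
move=> fd gd s Ds.
rewrite (_ : (fun u => _) = fun u => (u - s)^-1 *: (f u - f s) * g u
    + f s * ((u - s)^-1 *: (g u - g s))); last first.
  by apply/funext => u; rewrite /GRing.scale /=; ring.
apply: cvgD; apply: cvgM.
- exact: fd.
- exact: is_derive_on_cvg gd Ds.
- exact: cvg_cst.
- exact: gd.
Qed.

Lemma is_derive_onN (R : realType) (D : set R) (f df : R -> R^o) :
  is_derive_on D f df ->
  is_derive_on D (fun s => - f s) (fun s => - df s).
Proof.
move=> fd; have cd := is_derive_on_cst (V := R^o) (D := D) (-1).
have H := is_derive_onM cd fd.
by apply: (is_derive_on_eq H) => s _ /=; rewrite ?mul0r ?add0r mulN1r.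
Qed.

(** Carathéodory's form of the derivative: the slope of g at f s, completed by
    g' (f s), is continuous there, which avoids dividing by f u - f s. *)
Lemma is_derive_on_comp (R : realType) (D : set R) (f df : R -> R^o)
    (g dg : R -> R) :
  is_derive_on D f df ->
  (forall s, D s -> is_derive (f s : R^o) 1 (g : R^o -> R^o) (dg (f s))) ->
  is_derive_on D (fun s => g (f s) : R^o) (fun s => dg (f s) * df s).
Proof.
move=> fd gd s Ds.
have [+ gE] := gd s Ds; move=> /cvg_ex /= [l gl].
have {gE} gE : dg (f s) = l by rewrite -gE; exact/cvg_lim.
rewrite gE.
pose slope h := if h == 0 then l else h^-1 * (g (h + f s) - g (f s)).
have slope_cvg : slope h @[h --> (0 : R)] --> slope 0.
  apply/continuous_withinNx; rewrite {2}/slope eqxx.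
  apply: cvg_trans gl; apply: near_eq_cvg; near=> h.
  have h0 : h != 0 by near: h; exact: nbhs_dnbhs_neq.
  by rewrite /slope (negbTE h0) /= /GRing.scale /= mulr1.
have fs : (f u - f s) @[u --> within D s^'] --> (0 : R).
  rewrite -(subrr (f s)); apply: cvgB; last exact: cvg_cst.
  exact: is_derive_on_cvg fd Ds.
have H : slope (f u - f s) * ((u - s)^-1 *: (f u - f s))
    @[u --> within D s^'] --> slope 0 * df s.
  by apply: cvgM; [exact: cvg_comp fs slope_cvg | exact: fd].
rewrite {2}/slope eqxx in H; apply: cvg_trans H.
apply: near_eq_cvg; apply: nearW => u /=.
rewrite /slope /GRing.scale /= subr_eq0; case: eqP => [->|/eqP fus].
  by rewrite !subrr !mulr0.
rewrite subrK mulrCA; congr (_ * _).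
by rewrite mulrAC mulVf ?mul1r// subr_eq0.
Unshelve. all: by end_near. Qed.

Lemma is_derive_on_div (R : realType) (D : set R) (f g df dg : R -> R^o) :
  (forall s, D s -> g s != 0) ->
  is_derive_on D f df -> is_derive_on D g dg ->
  is_derive_on D (fun s => f s / g s : R^o)
                 (fun s => (df s * g s - f s * dg s) / g s ^+ 2).
Proof.
move=> g0 fd gd.
have Vd : is_derive_on D (fun s => (g s)^-1 : R^o)
    (fun s => - (g s) ^- 2 * dg s).
  apply: (is_derive_on_comp (g := @GRing.inv R) (dg := fun y => - y ^- 2) gd).
  move=> s Ds.
  have := is_deriveV (g0 s Ds) (is_derive_id (g s : R^o) (1 : R^o)).
  by rewrite /GRing.scale /= mulr1.
apply: (is_derive_on_eq (is_derive_onM fd Vd)) => // s Ds /=.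
by have := g0 s Ds; move=> ?; field.
Qed.

Lemma is_derive_on_sqrt (R : realType) (D : set R) (f df : R -> R^o) :
  (forall s, D s -> 0 < f s) -> is_derive_on D f df ->
  is_derive_on D (fun s => Num.sqrt (f s) : R^o)
                 (fun s => df s / (2 * Num.sqrt (f s))).
Proof.
move=> f0 fd.
apply: (is_derive_on_eq (is_derive_on_comp (g := Num.sqrt)
  (dg := fun y => (2 * Num.sqrt y)^-1) fd _)) => // [s Ds | s _].
  exact: is_derive1_sqrt (f0 s Ds).
by rewrite mulrC.
Qed.

(** * Vectors of three-space *)

Lemma vec3E (R : realType) (x y z : R) :
  (vec3 x y z 0 0 = x) * (vec3 x y z 0 1 = y) * (vec3 x y z 0 2 = z).
Proof. by rewrite !mxE. Qed.

Lemma rV3P (R : realType) (u v : 'rV[R]_3) :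
  u 0 0 = v 0 0 -> u 0 1 = v 0 1 -> u 0 2 = v 0 2 -> u = v.
Proof.
move=> e0 e1 e2; apply/rowP => -[[|[|[|//]]] i3].
- by rewrite (_ : Ordinal i3 = 0) //; exact: val_inj.
- by rewrite (_ : Ordinal i3 = 1) //; exact: val_inj.
- by rewrite (_ : Ordinal i3 = 2) //; exact: val_inj.
Qed.

Lemma dotE (R : realType) (u v : 'rV[R]_3) :
  dot u v = u 0 0 * v 0 0 + u 0 1 * v 0 1 + u 0 2 * v 0 2.
Proof.
rewrite /dot !big_ord_recr big_ord0 /= add0r.
by congr (u 0 _ * v 0 _ + u 0 _ * v 0 _ + u 0 _ * v 0 _); exact: val_inj.
Qed.

Lemma is_derive_on_rowP (R : realType) (n : nat) (D : set R)
    (f df : R -> 'rV[R]_n.+1) :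
  is_derive_on D f df <->
  (forall i, is_derive_on D (fun s => f s 0 i : R^o) (fun s => df s 0 i)).
Proof.
split=> [fd i s Ds|fd s Ds].
  have := cvg_comp _ _ (fd s Ds) (@coord_continuous R _ _ 0 i (df s)).
  by apply: cvg_trans; apply: near_eq_cvg; apply: nearW => u; rewrite /= !mxE.
apply/cvg_ballP => e e0.
have H i : \forall u \near within D s^',
    ball (df s 0 i) e ((u - s)^-1 *: (f u 0 i - f s 0 i)).
  by have /cvg_ballP := fd i s Ds; apply.
have : \forall u \near within D s^', forall i,
    ball (df s 0 i) e ((u - s)^-1 *: (f u 0 i - f s 0 i)).
  exact: filter_forall.
apply: filterS => u Hu; split => // i j; rewrite ord1 !mxE; exact: Hu.
Qed.

Lemma dotC (R : realType) (u v : 'rV[R]_3) : dot u v = dot v u.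
Proof. by rewrite !dotE; ring. Qed.

Lemma dotZr (R : realType) (a : R) (u v : 'rV[R]_3) :
  dot u (a *: v) = a * dot u v.
Proof. by rewrite !dotE !mxE; ring. Qed.

Lemma dot_delta (R : realType) (u : 'rV[R]_3) (i : 'I_3) :
  dot u (delta_mx 0 i) = u 0 i.
Proof.
rewrite /dot (bigD1 i) //= mxE !eqxx mulr1 big1 ?addr0 // => j ji.
by rewrite mxE (negbTE ji) mulr0.
Qed.

Lemma enormE (R : realType) (u : 'rV[R]_3) (a : R) :
  0 <= a -> (enorm u = a) <-> (dot u u = a ^+ 2).
Proof.
move=> a0; rewrite /enorm; split=> [<-|->]; last by rewrite sqrtr_sqr ger0_norm.
rewrite sqr_sqrtr // dotE -!expr2; nra.
Qed.

Lemma dot_cross_l (R : realType) (u v : 'rV[R]_3) : dot u (cross u v) = 0.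
Proof. by rewrite !dotE /cross !vec3E; ring. Qed.

Lemma dot_cross_r (R : realType) (u v : 'rV[R]_3) : dot v (cross u v) = 0.
Proof. by rewrite !dotE /cross !vec3E; ring. Qed.

Lemma dot_cross_cross (R : realType) (u v : 'rV[R]_3) :
  dot (cross u v) (cross u v) = dot u u * dot v v - dot u v ^+ 2.
Proof. by rewrite !dotE /cross !vec3E; ring. Qed.

Lemma double_cross (R : realType) (u v : 'rV[R]_3) :
  cross u (cross u v) = dot u v *: u - dot u u *: v.
Proof. by apply: rV3P; rewrite /cross !mxE /= !dotE; ring. Qed.

(** Differentiating b = t x n by the product rule, the first two Frenet
    equations leave only tau t x (t x n), so that they imply the third. *)
Lemma binormal_derivative (R : realType) (k tau : R) (t n : 'rV[R]_3) :
  dot t t = 1 -> dot t n = 0 ->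
  cross (k *: n) n + cross t (- k *: t + tau *: cross t n) = - tau *: n.
Proof.
move=> t1 tn; transitivity (tau *: cross t (cross t n)).
  by apply: rV3P; rewrite /cross !mxE /=; ring.
by rewrite double_cross t1 tn scale0r scale1r sub0r scalerN scaleNr.
Qed.

Lemma is_derive_on_dot (R : realType) (D : set R) (f g df dg : R -> 'rV[R]_3) :
  is_derive_on D f df -> is_derive_on D g dg ->
  is_derive_on D (fun s => dot (f s) (g s) : R^o)
                 (fun s => dot (df s) (g s) + dot (f s) (dg s)).
Proof.
move=> /is_derive_on_rowP fd /is_derive_on_rowP gd.
apply: is_derive_on_eq (is_derive_onD (is_derive_onD
  (is_derive_onM (fd 0) (gd 0)) (is_derive_onM (fd 1) (gd 1)))
  (is_derive_onM (fd 2) (gd 2))) _ _ => s _; rewrite !dotE //.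
by ring.
Qed.

Lemma is_derive_on_vec3 (R : realType) (D : set R)
    (x y z dx dy dz : R -> R^o) :
  is_derive_on D x dx -> is_derive_on D y dy -> is_derive_on D z dz ->
  is_derive_on D (fun s => vec3 (x s) (y s) (z s))
                 (fun s => vec3 (dx s) (dy s) (dz s)).
Proof.
move=> xd yd zd; apply/is_derive_on_rowP => i.
have [->|->|->] : [\/ i = 0, i = 1 | i = 2].
  case: i => -[|[|[|//]]] i3;
    [constructor 1 | constructor 2 | constructor 3]; exact: val_inj.
- by apply: (is_derive_on_eq xd) => s _; rewrite vec3E.
- by apply: (is_derive_on_eq yd) => s _; rewrite vec3E.
- by apply: (is_derive_on_eq zd) => s _; rewrite vec3E.
Qed.

Lemma is_derive_on_cross (R : realType) (D : set R)
    (f g df dg : R -> 'rV[R]_3) :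
  is_derive_on D f df -> is_derive_on D g dg ->
  is_derive_on D (fun s => cross (f s) (g s))
                 (fun s => cross (df s) (g s) + cross (f s) (dg s)).
Proof.
move=> /is_derive_on_rowP fd /is_derive_on_rowP gd.
have minor i j : is_derive_on D
    (fun s => f s 0 i * g s 0 j - f s 0 j * g s 0 i : R^o)
    (fun s => df s 0 i * g s 0 j + f s 0 i * dg s 0 j
            - (df s 0 j * g s 0 i + f s 0 j * dg s 0 i)).
  exact: is_derive_onD (is_derive_onM (fd i) (gd j))
    (is_derive_onN (is_derive_onM (fd j) (gd i))).
apply: is_derive_on_eq (is_derive_on_vec3 (minor 1 2) (minor 2 0) (minor 0 1)) _ _
  => // s _.
by apply: rV3P; rewrite /cross !mxE /=; ring.
Qed.

Lemma is_derive_on_mulmxr (R : realType) (D : set R) (M : 'M[R]_3)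
    (f df : R -> 'rV[R]_3) :
  is_derive_on D f df ->
  is_derive_on D (fun s => f s *m M) (fun s => df s *m M).
Proof.
move=> fd; apply/is_derive_on_rowP => i.
have E u : dot u (col i M)^T = (u *m M) 0 i.
  by rewrite mxE; apply: eq_bigr => j _; rewrite !mxE.
apply: is_derive_on_eq
  (is_derive_on_dot fd (is_derive_on_cst (V := 'rV[R]_3) (col i M)^T)) _ _ => s _.
  exact: E.
rewrite -E [X in _ + X](_ : _ = 0) ?addr0 //.
by rewrite dotE !mxE !mulr0 !addr0.
Qed.

(** * Orthonormal frames *)

(** Differentiate dot t t = 1. *)
Lemma unit_derive_orthogonal (R : realType) (D : set R)
    (t acc : R -> 'rV[R]_3) (s : R) :
  nondegenerate_interval D -> is_derive_on D t acc ->
  (forall s, D s -> dot (t s) (t s) = 1) -> D s -> dot (t s) (acc s) = 0.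
Proof.
move=> nD td t1 Ds.
have cd : is_derive_on D (fun s => dot (t s) (t s) : R^o) (fun=> 0).
  by apply: (is_derive_on_eq (is_derive_on_cst (V := R^o) 1)) => // u /t1 ->.
have := is_derive_on_unique nD (is_derive_on_dot td td) cd Ds.
by rewrite (dotC (acc s)) => ?; lra.
Qed.

Definition frame_mx (R : realType) (t n b : 'rV[R]_3) : 'M[R]_3 :=
  \matrix_(i < 3) [:: t; n; b]`_i.

Lemma det3E (R : realType) (A : 'M[R]_3) :
  \det A = A 0 0 * (A 1 1 * A 2 2 - A 1 2 * A 2 1)
         - A 0 1 * (A 1 0 * A 2 2 - A 1 2 * A 2 0)
         + A 0 2 * (A 1 0 * A 2 1 - A 1 1 * A 2 0).
Proof.
rewrite (expand_det_row _ 0) !big_ord_recl big_ord0 /cofactor.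
rewrite !(expand_det_row _ 0) !big_ord_recl !big_ord0 /cofactor !det_mx11 !mxE.
(* With natural numbers as indices, the different forms that an ordinal takes
   after the two expansions are identified by computation. *)
pose a (i j : nat) := A (inord i) (inord j).
have aE i j : A i j = a i j by rewrite /a !inord_val.
rewrite !aE /= /bump /=; ring.
Qed.

Lemma frame_mx_row (R : realType) (t n b : 'rV[R]_3) :
  (forall j, frame_mx t n b 0 j = t 0 j) *
  (forall j, frame_mx t n b 1 j = n 0 j) *
  (forall j, frame_mx t n b 2 j = b 0 j).
Proof. by split; [split|] => j; rewrite mxE. Qed.

Lemma det_frame_mx (R : realType) (t n b : 'rV[R]_3) :
  \det (frame_mx t n b) = dot (cross t n) b.
Proof. by rewrite det3E !frame_mx_row dotE /cross !vec3E; ring. Qed.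

Lemma frame_mx_orthogonal (R : realType) (t n : 'rV[R]_3) :
  dot t t = 1 -> dot n n = 1 -> dot t n = 0 ->
  frame_mx t n (cross t n) *m (frame_mx t n (cross t n))^T = 1%:M.
Proof.
move=> t1 n1 tn; have b1 := dot_cross_cross t n.
rewrite t1 n1 tn mulr1 expr0n /= subr0 in b1.
apply/matrixP => i j.
have -> : (frame_mx t n (cross t n) *m (frame_mx t n (cross t n))^T) i j
    = dot [:: t; n; cross t n]`_i [:: t; n; cross t n]`_j.
  by rewrite mxE; apply: eq_bigr => k _; rewrite !mxE.
rewrite mxE; case: i j => -[|[|[|//]]] ? [[|[|[|//]]] ?] /=.
- exact: t1.
- exact: tn.
- exact: dot_cross_l.
- by rewrite dotC.
- exact: n1.
- exact: dot_cross_r.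
- by rewrite dotC dot_cross_l.
- by rewrite dotC dot_cross_r.
- exact: b1.
Qed.

(** * Sufficiency: a curve from its height along the axis *)

(** Coordinates along the radial, the angular and the axial direction at the
    angle th. *)
Definition cyl (R : realType) (th f g h : R) : 'rV[R]_3 :=
  vec3 (f * cos th - g * sin th) (f * sin th + g * cos th) h.

Lemma dot_cyl (R : realType) (th f g h f' g' h' : R) :
  dot (cyl th f g h) (cyl th f' g' h') = f * f' + g * g' + h * h'.
Proof.
rewrite dotE /cyl !vec3E.
transitivity ((f * f' + g * g') * (cos th ^+ 2 + sin th ^+ 2) + h * h').
  by ring.
by rewrite cos2Dsin2 mulr1.
Qed.

Lemma cross_cyl (R : realType) (th f g h f' g' h' : R) :
  cross (cyl th f g h) (cyl th f' g' h') =
  cyl th (g * h' - h * g') (h * f' - f * h') (f * g' - g * f').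
Proof.
apply: rV3P; rewrite /cross /cyl !vec3E; [ring | ring |].
transitivity ((f * g' - g * f') * (cos th ^+ 2 + sin th ^+ 2)); first by ring.
by rewrite cos2Dsin2 mulr1.
Qed.

Lemma scale_cyl (R : realType) (th a f g h : R) :
  a *: cyl th f g h = cyl th (a * f) (a * g) (a * h).
Proof. by apply: rV3P; rewrite /cyl !mxE /=; ring. Qed.

Lemma add_cyl (R : realType) (th f g h f' g' h' : R) :
  cyl th f g h + cyl th f' g' h' = cyl th (f + f') (g + g') (h + h').
Proof. by apply: rV3P; rewrite /cyl !mxE /=; ring. Qed.

(** The terms with dth come from the rotation of the radial and angular unit
    vectors e and e': they have the derivatives dth e' and - dth e. *)
Lemma is_derive_on_cyl (R : realType) (D : set R)
    (th f g h dth df dg dh : R -> R^o) :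
  is_derive_on D th dth -> is_derive_on D f df -> is_derive_on D g dg ->
  is_derive_on D h dh ->
  is_derive_on D (fun s => cyl (th s) (f s) (g s) (h s))
    (fun s => cyl (th s) (df s - g s * dth s) (dg s + f s * dth s) (dh s)).
Proof.
move=> thd fd gd hd.
have cd := is_derive_on_comp (dg := fun y => - sin y) thd
  (fun s _ => is_derive_cos (th s)).
have sd := is_derive_on_comp thd (fun s _ => is_derive_sin (th s)).
apply: (is_derive_on_eq (is_derive_on_vec3
  (is_derive_onD (is_derive_onM fd cd) (is_derive_onN (is_derive_onM gd sd)))
  (is_derive_onD (is_derive_onM fd sd) (is_derive_onM gd cd)) hd)) => // s _.
by apply: rV3P; rewrite /cyl !vec3E; ring.
Qed.

(** Here q and P are the heights of n and b, and theta is the longitude of the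
    tangent on the sphere; its derivative, a quotient by r ^+ 2, is the one that
    gives t' the length kappa. *)
Lemma frenet_cyl (R : realType) (K : set R)
    (kappa tau xi q P r theta x y z : R -> R^o) :
  (forall s, K s -> 0 < kappa s) ->
  (forall s, K s -> 0 < 1 - xi s ^+ 2 - q s ^+ 2) ->
  (forall s, K s -> P s = Num.sqrt (1 - xi s ^+ 2 - q s ^+ 2)) ->
  (forall s, K s -> r s = Num.sqrt (1 - xi s ^+ 2)) ->
  is_derive_on K xi (fun s => kappa s * q s) ->
  is_derive_on K q (fun s => - kappa s * xi s + tau s * P s) ->
  is_derive_on K theta (fun s => kappa s * P s / r s ^+ 2) ->
  is_derive_on K x (fun s => r s * cos (theta s)) ->
  is_derive_on K y (fun s => r s * sin (theta s)) ->
  is_derive_on K z xi ->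
  frenet K (fun s => vec3 (x s) (y s) (z s)) kappa tau
    (fun s => cyl (theta s) (r s) 0 (xi s))
    (fun s => cyl (theta s) (- (xi s * q s) / r s) (P s / r s) (q s))
    (fun s => cyl (theta s) (- (xi s * P s) / r s) (- q s / r s) (P s)).
Proof.
move=> k0 rad0 PE rE xid qd thd xd yd zd.
have xi0 s : K s -> 0 < 1 - xi s ^+ 2.
  by move=> /rad0; have := sqr_ge0 (q s); lra.
have r0 s : K s -> 0 < r s by move=> Ks; rewrite rE // sqrtr_gt0 xi0.
have P0 s : K s -> 0 < P s by move=> Ks; rewrite PE // sqrtr_gt0 rad0.
have r2 s : K s -> r s ^+ 2 = 1 - xi s ^+ 2.
  by move=> Ks; rewrite rE // sqr_sqrtr // ltW // xi0.
have P2 s : K s -> P s ^+ 2 = 1 - xi s ^+ 2 - q s ^+ 2.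
  by move=> Ks; rewrite PE // sqr_sqrtr // ltW // rad0.
have rn0 s : K s -> r s != 0 by move=> /r0 /lt0r_neq0.
have Pn0 s : K s -> P s != 0 by move=> /P0 /lt0r_neq0.
have oned : is_derive_on K (fun=> 1 : R^o) (fun=> 0) by exact: is_derive_on_cst.
have xi2d := is_derive_onD oned (is_derive_onN (is_derive_onM xid xid)).
have rd : is_derive_on K r (fun s => - (xi s * kappa s * q s) / r s).
  apply: (is_derive_on_eq (is_derive_on_sqrt _ xi2d)) => s Ks.
  - exact: xi0.
  - by rewrite rE.
  - by have := rn0 s Ks; rewrite rE // expr2 => ?; field.
have Pd : is_derive_on K P (fun s => - tau s * q s).
  apply: (is_derive_on_eq (is_derive_on_sqrt _ (is_derive_onD xi2d
    (is_derive_onN (is_derive_onM qd qd))))) => s Ks.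
  - exact: rad0.
  - by rewrite PE.
  - by rewrite -!expr2 -PE //; have := Pn0 s Ks => ?; field.
have zerod : is_derive_on K (fun=> 0 : R^o) (fun=> 0).
  exact: is_derive_on_cst.
have td : is_derive_on K (fun s => cyl (theta s) (r s) 0 (xi s))
    (fun s => kappa s *: cyl (theta s) (- (xi s * q s) / r s) (P s / r s) (q s)).
  apply: (is_derive_on_eq (is_derive_on_cyl thd rd zerod xid)) => // s Ks.
  have := rn0 s Ks => ?; rewrite scale_cyl; congr cyl; field => //.
have t1 s : K s -> dot (cyl (theta s) (r s) 0 (xi s))
                       (cyl (theta s) (r s) 0 (xi s)) = 1.
  by move=> Ks; rewrite dot_cyl -expr2 r2 //; ring.
have n1 s : K s ->
    dot (cyl (theta s) (- (xi s * q s) / r s) (P s / r s) (q s))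
        (cyl (theta s) (- (xi s * q s) / r s) (P s / r s) (q s)) = 1.
  move=> Ks; rewrite dot_cyl.
  have rs0 := rn0 s Ks.
  transitivity ((xi s ^+ 2 * q s ^+ 2 + P s ^+ 2 + q s ^+ 2 * r s ^+ 2)
                / r s ^+ 2); first by field.
  apply: (mulIf (expf_neq0 2 rs0)); rewrite mulfVK ?expf_neq0 //.
  by rewrite P2 // r2 //; ring.
have tn s : K s -> dot (cyl (theta s) (r s) 0 (xi s))
    (cyl (theta s) (- (xi s * q s) / r s) (P s / r s) (q s)) = 0.
  by move=> Ks; rewrite dot_cyl; have := rn0 s Ks => ?; field.
have bE s : K s -> cyl (theta s) (- (xi s * P s) / r s) (- q s / r s) (P s) =
    cross (cyl (theta s) (r s) 0 (xi s))
      (cyl (theta s) (- (xi s * q s) / r s) (P s / r s) (q s)).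
  move=> Ks; have rs0 := rn0 s Ks; rewrite cross_cyl.
  congr cyl; [by field | | by field].
  transitivity (- (q s * (r s ^+ 2 + xi s ^+ 2)) / r s); last by field.
  by rewrite r2 // subrK mulr1.
have nd : is_derive_on K
    (fun s => cyl (theta s) (- (xi s * q s) / r s) (P s / r s) (q s))
    (fun s => - kappa s *: cyl (theta s) (r s) 0 (xi s) + tau s *:
      cyl (theta s) (- (xi s * P s) / r s) (- q s / r s) (P s)).
  apply: (is_derive_on_eq (is_derive_on_cyl thd
    (is_derive_on_div rn0 (is_derive_onN (is_derive_onM xid qd)) rd)
    (is_derive_on_div rn0 Pd rd) qd)) => // s Ks.
  have rs0 := rn0 s Ks; rewrite !scale_cyl add_cyl; congr cyl.
  - (* Both sides are polynomials divided by r^3; their difference has the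
       factor r^2 (r^2 + xi^2) - q^2 (r^2 + xi^2) - P^2 = r^2 - q^2 - P^2. *)
    have E : (r s ^+ 2 - q s ^+ 2) * (r s ^+ 2 + xi s ^+ 2) - P s ^+ 2 = 0.
      by rewrite P2 // r2 //; ring.
    apply/eqP; rewrite -subr_eq0; apply/eqP.
    transitivity (kappa s * ((r s ^+ 2 - q s ^+ 2) * (r s ^+ 2 + xi s ^+ 2)
      - P s ^+ 2) / r s ^+ 3); first by field.
    by rewrite E mulr0 mul0r.
  - by field.
have xd' : is_derive_on K (fun s => vec3 (x s) (y s) (z s))
    (fun s => cyl (theta s) (r s) 0 (xi s)).
  apply: (is_derive_on_eq (is_derive_on_vec3 xd yd zd)) => // s _.
  by rewrite /cyl !mul0r subr0 addr0.
split=> //.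
- by split=> // s Ks; apply/enormE; rewrite // t1 // expr1n.
- exists (fun s => kappa s *:
    cyl (theta s) (- (xi s * q s) / r s) (P s / r s) (q s)) => // s Ks.
  split; last 2 first.
  - exact: k0.
  - by rewrite scalerA mulVf ?scale1r // lt0r_neq0 // k0.
  apply/esym/enormE; first exact: ltW (k0 s Ks).
  by rewrite dotZr dotC dotZr n1 // mulr1 -expr2.
- apply: (is_derive_on_eq (is_derive_on_cross td nd)) => s Ks.
    by rewrite bE.
  by rewrite bE // binormal_derivative // ?t1 ?tn.
Qed.

(** * Necessity: rotating the binormal into the positive octant *)

Lemma frenet_orthonormal (R : realType) (I : set R) (alpha : R -> 'rV[R]_3)
    (kappa tau : R -> R) (t n b : R -> 'rV[R]_3) (s : R) :
  nondegenerate_interval I -> frenet I alpha kappa tau t n b -> I s ->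
  [/\ dot (t s) (t s) = 1, dot (n s) (n s) = 1, dot (t s) (n s) = 0 &
      b s = cross (t s) (n s)].
Proof.
move=> nI [[_ t1] [acc td accE] bE _ _] Is.
have tt u : I u -> dot (t u) (t u) = 1.
  by move=> /t1 /enormE; rewrite expr1n; apply.
have [kE k0 nE] := accE s Is.
have kn0 := lt0r_neq0 k0.
split; [exact: tt | | | exact: bE].
- have /esym/enormE := kE; rewrite nE dotZr dotC dotZr => ->; last exact: ltW.
  by field.
- by rewrite nE dotZr (unit_derive_orthogonal nI td tt Is) mulr0.
Qed.

(** An orthogonal matrix has unit columns, its transpose being a left inverse
    as well. *)
Lemma orthogonal_col_sqr (R : realType) (t n b : 'rV[R]_3) (j : 'I_3) :
  frame_mx t n b *m (frame_mx t n b)^T = 1%:M ->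
  t 0 j ^+ 2 + n 0 j ^+ 2 + b 0 j ^+ 2 = 1.
Proof.
move=> /mulmx1C /matrixP /(_ j j); rewrite !mxE eqxx /= => H; apply: etrans H.
under eq_bigr do rewrite mxE -expr2.
by rewrite !big_ord_recr big_ord0 /= add0r !mxE.
Qed.

Lemma frame_mx_mul (R : realType) (t n b : 'rV[R]_3) (M : 'M[R]_3) :
  frame_mx t n b *m M = frame_mx (t *m M) (n *m M) (b *m M).
Proof.
apply/row_matrixP => i; rewrite row_mul !rowK.
by case: i => -[|[|[|//]]].
Qed.

Lemma dot_mulmx_orthogonal (R : realType) (M : 'M[R]_3) (u v : 'rV[R]_3) :
  M *m M^T = 1%:M -> dot (u *m M) (v *m M) = dot u v.
Proof.
have E (a b : 'rV[R]_3) : dot a b = (a *m b^T) 0 0.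
  by rewrite mxE; apply: eq_bigr => k _; rewrite mxE.
by move=> MM; rewrite !E trmx_mul mulmxA -(mulmxA u) MM mulmx1.
Qed.

Lemma lin1_mx_mulmxr (R : realType) (M : 'M[R]_3) :
  lin1_mx (mulmxr M : 'rV[R]_3 -> 'rV[R]_3) = M.
Proof. by apply/row_matrixP => i; rewrite !rowE mul_rV_lin1. Qed.

(** The rotation takes t, n, t x n to the rows g1, g2, g1 x g2 = (1, 2, 2) / 3
    of a rotation matrix with rational entries: if F and G are the two frames,
    it is right multiplication by F^T G. *)
Lemma exists_rotation_positive (R : realType) (t n : 'rV[R]_3) :
  dot t t = 1 -> dot n n = 1 -> dot t n = 0 ->
  exists M : 'M[R]_3, [/\ M *m M^T = 1%:M, \det M = 1 &
    forall i, 0 < (cross t n *m M) 0 i].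
Proof.
move=> t1 n1 tn.
pose g1 : 'rV[R]_3 := vec3 (2 / 3) (- 2 / 3) (1 / 3).
pose g2 : 'rV[R]_3 := vec3 (2 / 3) (1 / 3) (- 2 / 3).
have det1 (u v : 'rV[R]_3) : dot u u = 1 -> dot v v = 1 -> dot u v = 0 ->
    \det (frame_mx u v (cross u v)) = 1.
  move=> u1 v1 uv; rewrite det_frame_mx dot_cross_cross u1 v1 uv.
  by rewrite mulr1 expr0n subr0.
have g11 : dot g1 g1 = 1 by rewrite dotE !vec3E; field.
have g22 : dot g2 g2 = 1 by rewrite dotE !vec3E; field.
have g12 : dot g1 g2 = 0 by rewrite dotE !vec3E; field.
have FF := frame_mx_orthogonal t1 n1 tn.
have GG := frame_mx_orthogonal g11 g22 g12.
set F := frame_mx t n (cross t n) in FF.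
set G := frame_mx g1 g2 (cross g1 g2) in GG.
exists (F^T *m G); split.
- rewrite trmx_mul trmxK -mulmxA (mulmxA G) GG mul1mx; exact: mulmx1C.
- by rewrite det_mulmx det_tr !det1 // mulr1.
move=> i.
have -> : (cross t n *m (F^T *m G)) 0 i = cross g1 g2 0 i.
  rewrite -(frame_mx_row t n (cross t n *m (F^T *m G))).
  have /matrixP/(_ 2 i) : F *m (F^T *m G) = G by rewrite mulmxA FF mul1mx.
  by rewrite frame_mx_mul !frame_mx_row.
rewrite /cross /g1 /g2 !vec3E !mxE.
by case: i => -[|[|[|//]]] ? /=; lra.
Qed.

(** The component of the rotated binormal is continuous and positive at s0; on
    the ball where it stays positive it equals the square root in the
    equation, because rotation keeps the frame t, n, b orthonormal. *)
Lemma frenet_ivp (R : realType) (I : set R) (alpha : R -> 'rV[R]_3)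
    (kappa tau : R -> R) (t n b : R -> 'rV[R]_3) (s0 : R) (M : 'M[R]_3)
    (i : 'I_3) :
  nondegenerate_interval I -> frenet I alpha kappa tau t n b -> I s0 ->
  M *m M^T = 1%:M -> 0 < (b s0 *m M) 0 i ->
  exists2 delta : R, 0 < delta &
    ivp_solution (I `&` ball s0 delta) kappa tau s0
      ((t s0 *m M) 0 i) (kappa s0 * (n s0 *m M) 0 i)
      (fun s => (t s *m M) 0 i) (fun s => kappa s * (n s *m M) 0 i).
Proof.
move=> nI Fr Is0 MM b0.
have [[ad t1] [acc td accE] bE nd bd] := Fr.
have comp f df (fd : is_derive_on I f df) :=
  (is_derive_on_rowP I _ _).1 (is_derive_on_mulmxr (M := M) fd) i.
have /nbhs_ballP[delta /= d0 bpos] :=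
  is_derive_on_near_gt0 (comp _ _ bd) Is0 b0.
exists delta => //.
have DI : I `&` ball s0 delta `<=` I by move=> s [].
have kn0 s : I s -> kappa s != 0 by move=> /accE[_ /lt0r_neq0].
have qE s : I s -> (kappa s)^-1 * (kappa s * (n s *m M) 0 i) = (n s *m M) 0 i.
  by move=> Is; rewrite mulKf // kn0.
have radE s : I s -> radicand kappa (fun s => (t s *m M) 0 i)
    (fun s => kappa s * (n s *m M) 0 i) s = (b s *m M) 0 i ^+ 2.
  move=> Is; rewrite /radicand qE //.
  have [tt nn tn ->] := frenet_orthonormal nI Fr Is.
  have := @orthogonal_col_sqr R (t s *m M) (n s *m M)
    (cross (t s) (n s) *m M) i.
  rewrite -frame_mx_mul trmx_mul mulmxA -(mulmxA (frame_mx _ _ _)) MM mulmx1.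
  by move=> /(_ (frame_mx_orthogonal tt nn tn)) => ?; lra.
split=> //.
- apply: is_derive_on_subset DI _.
  apply: is_derive_on_eq (comp _ _ td) _ _ => // s Is.
  have [_ _ ->] := accE s Is.
  by rewrite -scalemxAl [in RHS]mxE mulVKf // kn0.
- by move=> s [Is _]; rewrite radE // sqr_ge0.
- apply: is_derive_on_eq (is_derive_on_subset DI (comp _ _ nd)) _ _ => s [Is sb].
    by rewrite qE.
  rewrite radE // sqrtr_sqr gtr0_norm; last exact: bpos.
  by rewrite mulmxDl -!scalemxAl !mxE.
- by split=> //; exact: ballxx.
Qed.

(** * The theorem *)

Theorem mainTheorem2 (R : realType) :
  (forall (a b : R) (kappa tau : R -> R^o) (eps s0 kappa0 w0 v0 : R)
      (J : set R) (xi dxi : R -> R^o),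
    C1_on `[a, b] kappa ->
    (forall s, s \in `[a, b] -> 0 < kappa s) ->
    {within `[a, b], continuous tau} ->
    0 < eps ->
    s0 \in `]a + eps, b - eps[ ->
    is_min_on `[a + eps, b - eps] kappa kappa0 ->
    w0 ^+ 2 + v0 ^+ 2 / kappa0 ^+ 2 < 1 ->
    nondegenerate_interval J ->
    J `<=` `[a, b] ->
    ivp_solution J kappa tau s0 w0 v0 xi dxi ->
    (\forall s \near s0, J s -> 0 < radicand kappa xi dxi s) /\
    (forall (K : set R) (theta x y z : R -> R^o),
      nondegenerate_interval K ->
      K `<=` J ->
      K s0 ->
      (forall s, K s -> 0 < radicand kappa xi dxi s) ->
      is_derive_on K theta (fun s =>
        Num.sqrt ((1 - xi s ^+ 2) * kappa s ^+ 2 - dxi s ^+ 2)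
        / (1 - xi s ^+ 2)) ->
      is_derive_on K x (fun s => Num.sqrt (1 - xi s ^+ 2) * cos (theta s)) ->
      is_derive_on K y (fun s => Num.sqrt (1 - xi s ^+ 2) * sin (theta s)) ->
      is_derive_on K z xi ->
      exists t n b' : R -> 'rV[R]_3,
        frenet K (fun s => vec3 (x s) (y s) (z s)) kappa tau t n b'))
  /\
  (forall (I : set R) (alpha : R -> 'rV[R]_3) (kappa tau : R -> R)
      (t n b : R -> 'rV[R]_3) (s0 : R),
    nondegenerate_interval I ->
    frenet I alpha kappa tau t n b ->
    I s0 ->
    exists sigma : {linear 'rV[R]_3 -> 'rV[R]_3},
      [/\ forall u v, dot (sigma u) (sigma v) = dot u v,
          0 < \det (lin1_mx sigma) &
          exists2 tbeta : R -> 'rV[R]_3,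
            is_derive_on I (sigma \o alpha) tbeta &
            forall i : 'I_3, exists2 delta : R, 0 < delta &
              exists dw : R -> R^o,
                ivp_solution (I `&` ball s0 delta) kappa tau s0
                  (dot (sigma (t s0)) (delta_mx 0 i))
                  (dot (kappa s0 *: sigma (n s0)) (delta_mx 0 i))
                  (fun s => dot (tbeta s) (delta_mx 0 i)) dw]).
Proof.
split=> [a b kappa tau eps s0 kappa0 w0 v0 J xi dxi _ k0 _ eps0 s0in kmin wv0
         nJ Jab [xid rad0 qd Js0 [xi0 dxi0]]
       |I alpha kappa tau t n b s0 nI Fr Is0].
- have oned : is_derive_on J (fun=> 1 : R^o) (fun=> 0).
    exact: is_derive_on_cst.
  have radd := is_derive_onD (is_derive_onD oned
    (is_derive_onN (is_derive_onM xid xid)))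
    (is_derive_onN (is_derive_onM qd qd)).
  (* kappa is least at kappa0, so (v0 / kappa s0)^2 <= (v0 / kappa0)^2. *)
  have rad_s0 : 0 < radicand kappa xi dxi s0.
    have [[c cin kc] kle] := kmin.
    have kappa0_gt0 : 0 < kappa0.
      rewrite -kc k0 //; move: cin; rewrite /= !in_itv /= => /andP[? ?].
      by apply/andP; split; lra.
    have kappa0_le : kappa0 <= kappa s0.
      apply: kle; exists s0 => //; move: s0in; rewrite /= !in_itv /=.
      by move=> /andP[? ?]; apply/andP; split; exact: ltW.
    have ks0 : 0 < kappa s0 by exact: lt_le_trans kappa0_le.
    rewrite /radicand xi0 dxi0 -addrA -opprD subr_gt0; apply: le_lt_trans wv0.
    rewrite lerD2l exprMn exprVn mulrC ler_wpM2l ?sqr_ge0 //.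
    by rewrite lef_pV2 ?posrE ?exprn_gt0 // ler_pXn2r ?nnegrE // ltW.
  split; first exact: is_derive_on_near_gt0 radd Js0 rad_s0.
  move=> K theta x y z nK KJ Ks0 radK thd xd yd zd.
  have kK s : K s -> 0 < kappa s by move=> /KJ/Jab; exact: k0.
  have dxiE s : K s -> dxi s = kappa s * ((kappa s)^-1 * dxi s).
    by move=> /kK/lt0r_neq0 ?; rewrite mulVKf.
  exists (fun s => cyl (theta s) (Num.sqrt (1 - xi s ^+ 2)) 0 (xi s)).
  eexists; eexists.
  apply: (@frenet_cyl R K kappa tau xi (fun s => (kappa s)^-1 * dxi s)
    (fun s => Num.sqrt (radicand kappa xi dxi s))
    (fun s => Num.sqrt (1 - xi s ^+ 2)) theta) => //.
  + by apply: (is_derive_on_eq (is_derive_on_subset KJ xid)).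
  + exact: is_derive_on_subset KJ qd.
  + apply: (is_derive_on_eq thd) => // s Ks.
    have ks := kK s Ks; have rads := radK s Ks.
    have xis : 0 < 1 - xi s ^+ 2.
      have := sqr_ge0 ((kappa s)^-1 * dxi s).
      by move: rads; rewrite /radicand; lra.
    rewrite [in RHS]sqr_sqrtr; last exact: ltW.
    congr (_ / _); rewrite -[in RHS](gtr0_norm ks).
    rewrite -sqrtr_sqr -sqrtrM ?sqr_ge0 //.
    congr Num.sqrt; rewrite /radicand; have := lt0r_neq0 ks => ?; by field.
- have [tt nn tn bE] := frenet_orthonormal nI Fr Is0.
  have [M [MM detM posM]] := exists_rotation_positive tt nn tn.
  exists (mulmxr M); split.
  + by move=> u v; exact: dot_mulmx_orthogonal.
  + by rewrite lin1_mx_mulmxr detM.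
  exists (fun s => t s *m M).
    by have [[ad _] _ _ _ _] := Fr; exact: is_derive_on_mulmxr.
  move=> i; have [|delta d0 ivp] := frenet_ivp (i := i) nI Fr Is0 MM.
    by rewrite bE.
  exists delta => //; exists (fun s => kappa s * (n s *m M) 0 i).
  have -> : (fun s => dot (t s *m M) (delta_mx 0 i)) = fun s => (t s *m M) 0 i.
    by apply/funext => s; rewrite dot_delta.
  by rewrite !dot_delta [X in ivp_solution _ _ _ _ _ X]mxE.
Qed.
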